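(* Let $V(z,\dot e)$ be a Recurrent Tracking Function over $S\subseteq\mathcal Z\times\mathbb R^n$ with rate $\beta$ (and constants $a_1,a_2$, recurrence time $\tau$), let $$h_V(z,\dot e)=-V(z,\dot e)+\alpha_e h(z),\qquad \alpha_e=\frac{a_1^2(\beta-\alpha)}{a_2C_hM},$$ where $h$ is a control barrier function for the reduced-order model with $\kappa(h)=\alpha h$, $0<\alpha<\beta$, and consider an initial state $x_0\in\mathcal S_{\mathrm{FoM}}$ of the full-order model such that $$(z_0,\dot e_0)\in S_V=\{(z,\dot e)\in\mathcal Z\times\mathbb R^n: h_V(z,\dot e)\ge0\}.$$ Then the solution $x_{\mathrm{cl}}(t)$ of the closed-loop system with $x_{\mathrm{cl}}(0)=x_0$ always remains in the safe set: $x_{\mathrm{cl}}(t)\in\mathcal S_{\mathrm{FoM}}$ for all $t\ge0$.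
   Context: **Models.** The full-order model (FoM) is $\dot x=F(x,u)$, $x\in\mathcal X\subseteq\mathbb R^N$, $u\in U\subseteq\mathbb R^{M_u}$, with $F$ continuous and locally Lipschitz in $x$ uniformly in $u$ (on every compact subset of $\mathcal X$), and forward complete (for every $x_0\in\mathcal X$ and measurable $u:\mathbb R_{\ge0}\to U$ the solution exists for all $t\ge0$). The reduced-order model (RoM) is $\dot z=f(z,v)$, $z\in\mathcal Z\subseteq\mathbb R^n$, $v\in\mathrm V\subseteq\mathbb R^m$, $n<N$, $m<M_u$, with $f$ locally Lipschitz. **Interconnection.** $\Pi:\mathcal X\to\mathcal Z$ is a projection map, $K:\mathcal X\times\mathrm V\to U$ a tracking interface, $k:\mathcal Z\to\mathrm V$ the RoM feedback law. The closed-loop FoM is $\dot x=F_{\mathrm{cl}}(x):=F(x,K(x,k(\Pi(x))))$, with trajectory $x_{\mathrm{cl}}(t)$, $x_{\mathrm{cl}}(0)=x_0$. Put $z_{\mathrm{cl}}(t)=\Pi(x_{\mathrm{cl}}(t))$, $z_0=\Pi(x_0)$. **Safe set.** $h:\mathcal Z\to\mathbb R$ is smooth and $\mathcal S_{\mathrm{FoM}}=\{x\in\mathcal X:h(\Pi(x))\ge0\}$. **Control barrier function.** $h$ is a CBF for the RoM with $\kappa(h)=\alpha h$ if $\max_{v\in\mathrm V}\big(\nabla h(z)^\top f(z,v)+\alpha h(z)\big)\ge0$ for all $z\in\mathcal Z$. **Tracking error.** The safe velocity reference $\dot z_s(t)$ generated by the RoM satisfies $\nabla h(z_{\mathrm{cl}}(t))^\top\dot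 z_s(t)\ge-\alpha h(z_{\mathrm{cl}}(t))$. The velocity tracking error is $\dot e(t)=\dot z_{\mathrm{cl}}(t)-\dot z_s(t)\in\mathbb R^n$, with $\dot e_0=\dot e(0)$. The symbol $\dot e$ is treated as a single variable. **Standing assumptions defining $C_h$ and $M$.** There is $C_h>0$ with $\|\nabla h(\Pi(x))\|\le C_h$ for all $x\in\mathcal S_{\mathrm{FoM}}$. There are positive constants $M$ and $\beta$ such that $\|\dot e(t)\|\le M\|\dot e_0\|e^{-\beta t}$ for all $t\ge0$. **Recurrent Tracking Function (RTF).** For $S\subseteq\mathcal Z\times\mathbb R^n$ let $T_S^e(x_0;\tau)=\{t\in(0,\tau]:(z_{\mathrm{cl}}(t),\dot e(t))\in S\}$. Let $S$ be compact with $0$ in the interior of $S_{\dot e}=\{\dot e\in\mathbb R^n:\exists z,\ (z,\dot e)\in S\}$. A continuous $V:\mathcal Z\times\mathbb R^n\to\mathbb R_{\ge0}$ is an RTF over $S$ with recurrence time $\tau>0$ and rate $\beta>0$ if (1) there are $a_1,a_2>0$ with $a_1\|\dot e\|\le V(z,\dot e)\le a_2\|\dot e\|$ for all $(z,\dot e)\in S$; and (2) for every $x_0\in\mathcal X$ with $(z_0,\dot e_0)\in S$, $\min_{t\in T_S^e(x_0;\tau)}e^{\beta t}V(z_{\mathrm{cl}}(t),\dot e(t))\le V(z_0,\dot e_0)$.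
   Formalization: The formal theorem additionally assumes that the initial pair (z_0, ė_0) lies in S; without this the claim fails, since the bounds a_1‖ė‖ ≤ V ≤ a_2‖ė‖ hold only on S and V may vanish at large ė outside S. *)

(* Defs.v *)
From HB Require Import structures.
From mathcomp Require Import all_boot all_order all_algebra.
From mathcomp Require Import all_classical all_reals all_analysis.

Set Implicit Arguments.
Unset Strict Implicit.
Unset Printing Implicit Defensive.

Import Order.TTheory GRing.Theory Num.Theory.
Import numFieldNormedType.Exports.

Local Open Scope classical_set_scope.
Local Open Scope ring_scope.

(* R^n is 'rV[R]_n.  The library norm on 'rV[R]_n is the sup norm: it is
   used below only for topological notions and Lipschitz conditions, which do
   not depend on the choice of the norm.
   Every quantitative bound uses the Euclidean norm [enorm].

   Maps between subsets, such as h : Z -> R, are represented by functions on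
   the ambient space of which only the values on the subset matter; signals
   on [0, +oo) by functions on R of which only the values at t >= 0 matter. *)

Section Euclidean.
Context {R : realType}.
Implicit Types n : nat.

Definition dot n (x y : 'rV[R]_n) : R := \sum_(i < n) x ord0 i * y ord0 i.

Definition enorm n (x : 'rV[R]_n) : R := Num.sqrt (dot x x).

Definition partial n (i : 'I_n) (g : 'rV[R]_n -> R) : 'rV[R]_n -> R :=
  fun z => 'D_(delta_mx ord0 i) g z.

Definition grad n (g : 'rV[R]_n -> R) (z : 'rV[R]_n) : 'rV[R]_n :=
  \row_(i < n) partial i g z.

(* C^oo on a neighbourhood of A: every iterated partial derivative, of any
   order (order 0 is [s = [::]]), is differentiable there. *)
Definition smooth_on n (A : set 'rV[R]_n) (g : 'rV[R]_n -> R) : Prop :=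
  exists O : set 'rV[R]_n, [/\ open O, A `<=` O &
    forall (s : seq 'I_n) (z : 'rV[R]_n), O z ->
      differentiable (foldr (@partial n) g s) z].

Definition is_max (A : set R) (m : R) : Prop := A m /\ ubound A m.
Definition is_min (A : set R) (m : R) : Prop := A m /\ lbound A m.

End Euclidean.

Section Trajectories.
Context {R : realType}.
Implicit Types n N m : nat.

(* The limit of these quotients along [halfline_at t] is the two-sided
   derivative at t > 0 and the right derivative at t = 0. *)
Definition diff_quotient n (x : R -> 'rV[R]_n) (t s : R) : 'rV[R]_n :=
  (s - t)^-1 *: (x s - x t).

Definition halfline_at (t : R) : set_system R :=
  within [set s | 0 <= s] (t^').

Definition differentiable_halfline n (x : R -> 'rV[R]_n) : Prop :=
  forall t : R, 0 <= t -> cvg (diff_quotient x t s @[s --> halfline_at t]).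

Definition velocity n (x : R -> 'rV[R]_n) (t : R) : 'rV[R]_n :=
  lim (diff_quotient x t s @[s --> halfline_at t]).

Definition classical_solution N (X : set 'rV[R]_N) (G : 'rV[R]_N -> 'rV[R]_N)
    (x0 : 'rV[R]_N) (x : R -> 'rV[R]_N) : Prop :=
  x 0 = x0 /\
  forall t : R, 0 <= t ->
    X (x t) /\ diff_quotient x t s @[s --> halfline_at t] --> G (x t).

(* Solution in the sense of Caratheodory, as the input is only measurable. *)
Definition caratheodory_solution N m (X : set 'rV[R]_N)
    (F : 'rV[R]_N -> 'rV[R]_m -> 'rV[R]_N) (u : R -> 'rV[R]_m)
    (x0 : 'rV[R]_N) (x : R -> 'rV[R]_N) : Prop :=
  forall t : R, 0 <= t -> X (x t) /\ forall i : 'I_N,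
    (@lebesgue_measure R).-integrable `[0, t]
       (fun s => (F (x s) (u s) ord0 i)%:E) /\
    x t ord0 i =
      x0 ord0 i + \int[@lebesgue_measure R]_(s in `[0, t]) F (x s) (u s) ord0 i.

Definition forward_complete N m (X : set 'rV[R]_N) (U : set 'rV[R]_m)
    (F : 'rV[R]_N -> 'rV[R]_m -> 'rV[R]_N) : Prop :=
  forall (x0 : 'rV[R]_N) (u : R -> 'rV[R]_m), X x0 ->
    (forall i : 'I_m, measurable_fun (`[0, +oo[%classic : set R) (fun t => u t ord0 i)) ->
    (forall t : R, 0 <= t -> U (u t)) ->
    exists x, caratheodory_solution X F u x0 x.

End Trajectories.

Section Models.
Context {R : realType}.
Implicit Types n N m M : nat.

Definition FoM N M (X : set 'rV[R]_N) (U : set 'rV[R]_M)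
    (F : 'rV[R]_N -> 'rV[R]_M -> 'rV[R]_N) : Prop :=
  [/\ {within X `*` U, continuous (fun p => F p.1 p.2)},
      forall C : set 'rV[R]_N, compact C -> C `<=` X ->
        exists L : R, forall u, U u -> forall x y, C x -> C y ->
          enorm (F x u - F y u) <= L * enorm (x - y)
    & forward_complete X U F].

Definition RoM n m (Z : set 'rV[R]_n) (Vin : set 'rV[R]_m)
    (f : 'rV[R]_n -> 'rV[R]_m -> 'rV[R]_n) : Prop :=
  forall p : 'rV[R]_n * 'rV[R]_m, (Z `*` Vin) p ->
    exists2 B : set ('rV[R]_n * 'rV[R]_m), nbhs p B &
      [lipschitz f q.1 q.2 | q in B `&` (Z `*` Vin)].

Definition interconnection N M n m
    (X : set 'rV[R]_N) (U : set 'rV[R]_M) (Z : set 'rV[R]_n)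
    (Vin : set 'rV[R]_m) (Pi : 'rV[R]_N -> 'rV[R]_n)
    (K : 'rV[R]_N -> 'rV[R]_m -> 'rV[R]_M) (k : 'rV[R]_n -> 'rV[R]_m) : Prop :=
  [/\ forall x, X x -> Z (Pi x),
      forall x v, X x -> Vin v -> U (K x v)
    & forall z, Z z -> Vin (k z)].

Definition closed_loop N M n m (F : 'rV[R]_N -> 'rV[R]_M -> 'rV[R]_N)
    (Pi : 'rV[R]_N -> 'rV[R]_n) (K : 'rV[R]_N -> 'rV[R]_m -> 'rV[R]_M)
    (k : 'rV[R]_n -> 'rV[R]_m) : 'rV[R]_N -> 'rV[R]_N :=
  fun x => F x (K x (k (Pi x))).

Definition S_FoM N n (X : set 'rV[R]_N) (Pi : 'rV[R]_N -> 'rV[R]_n)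
    (h : 'rV[R]_n -> R) : set 'rV[R]_N :=
  [set x | X x /\ 0 <= h (Pi x)].

Definition CBF n m (Z : set 'rV[R]_n) (Vin : set 'rV[R]_m)
    (f : 'rV[R]_n -> 'rV[R]_m -> 'rV[R]_n) (alpha : R)
    (h : 'rV[R]_n -> R) : Prop :=
  forall z, Z z -> exists mx : R,
    is_max [set dot (grad h z) (f z v) + alpha * h z | v in Vin] mx /\ 0 <= mx.

(* [zs_dot] is the reference velocity; at each time it is a velocity that the
   reduced-order model can produce.  The point at which f is evaluated is left
   free: it may be z t, or the state of a separate copy of the model. *)
Definition safe_reference n m (Z : set 'rV[R]_n) (Vin : set 'rV[R]_m)
    (f : 'rV[R]_n -> 'rV[R]_m -> 'rV[R]_n) (alpha : R) (h : 'rV[R]_n -> R)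
    (z zs_dot : R -> 'rV[R]_n) : Prop :=
  forall t : R, 0 <= t ->
    (exists zs v, [/\ Z zs, Vin v & zs_dot t = f zs v]) /\
    - alpha * h (z t) <= dot (grad h (z t)) (zs_dot t).

(* Below, [xcl x] and [zs_dot x] are the closed-loop trajectory and the
   reference velocity associated with the initial state [x]. *)
Definition z_cl N n (Pi : 'rV[R]_N -> 'rV[R]_n) (xcl : 'rV[R]_N -> R -> 'rV[R]_N)
    (x : 'rV[R]_N) : R -> 'rV[R]_n :=
  fun t => Pi (xcl x t).

Definition e_dot N n (Pi : 'rV[R]_N -> 'rV[R]_n) (xcl : 'rV[R]_N -> R -> 'rV[R]_N)
    (zs_dot : 'rV[R]_N -> R -> 'rV[R]_n) (x : 'rV[R]_N) : R -> 'rV[R]_n :=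
  fun t => velocity (z_cl Pi xcl x) t - zs_dot x t.

End Models.

Section RecurrentTracking.
Context {R : realType}.
Implicit Types n N : nat.

Definition error_slice n (S : set ('rV[R]_n * 'rV[R]_n)) : set 'rV[R]_n :=
  [set e | exists z, S (z, e)].

Definition recurrence_times n (S : set ('rV[R]_n * 'rV[R]_n))
    (z e : R -> 'rV[R]_n) (tau : R) : set R :=
  [set t | 0 < t <= tau /\ S (z t, e t)].

Definition RTF N n (X : set 'rV[R]_N) (Z : set 'rV[R]_n)
    (z e : 'rV[R]_N -> R -> 'rV[R]_n) (* indexed by the initial state *)
    (S : set ('rV[R]_n * 'rV[R]_n)) (a1 a2 tau beta : R)
    (V : 'rV[R]_n * 'rV[R]_n -> R) : Prop :=
  [/\ [/\ S `<=` Z `*` setT, compact S & (error_slice S)^° 0],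
      [/\ {within Z `*` setT, continuous V},
          forall p, (Z `*` setT) p -> 0 <= V p,
          0 < tau & 0 < beta],
      [/\ 0 < a1, 0 < a2 &
          forall p, S p -> a1 * enorm p.2 <= V p <= a2 * enorm p.2]
    & forall x0, X x0 -> S (z x0 0, e x0 0) ->
        exists mn : R,
          is_min [set expR (beta * t) * V (z x0 t, e x0 t) |
                   t in recurrence_times S (z x0) (e x0) tau] mn /\
          mn <= V (z x0 0, e x0 0)].

Definition alpha_e (a1 a2 alpha beta Ch M : R) : R :=
  a1 ^+ 2 * (beta - alpha) / (a2 * Ch * M).

Definition h_V n (V : 'rV[R]_n * 'rV[R]_n -> R) (h : 'rV[R]_n -> R) (ae : R)
    (p : 'rV[R]_n * 'rV[R]_n) : R :=
  - V p + ae * h p.1.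

Definition S_V n (Z : set 'rV[R]_n) (V : 'rV[R]_n * 'rV[R]_n -> R)
    (h : 'rV[R]_n -> R) (ae : R) : set ('rV[R]_n * 'rV[R]_n) :=
  [set p | Z p.1 /\ 0 <= h_V V h ae p].

End RecurrentTracking.

(* Main.v *)
(* Put H(t) = h(z_cl(t)) and c = Ch M |e_dot(0)| / (beta - alpha).  The safe
   reference, Cauchy-Schwarz and the decay of e_dot give
     H' >= - alpha H - Ch M |e_dot(0)| exp(- beta t)
   as long as the state is safe, so exp(alpha t) H(t) - c exp(-(beta - alpha) t)
   is nondecreasing.  Since a1 <= a2 unless e_dot(0) = 0, membership in S and
   S_V gives c <= H(0), hence H(t) >= c exp(- beta t) up to the first exit time,
   which excludes an exit when c > 0.  When c = 0 the error vanishes identically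
   and the inequality holds at all times. *)
Require Import Defs.
From HB Require Import structures.
From mathcomp Require Import all_boot all_order all_algebra.
From mathcomp Require Import all_classical all_reals all_analysis.
From mathcomp Require Import ring lra.
Set Implicit Arguments.
Unset Strict Implicit.
Unset Printing Implicit Defensive.
Import Order.TTheory GRing.Theory Num.Theory.
Import numFieldNormedType.Exports.
Local Open Scope classical_set_scope.
Local Open Scope ring_scope.

(** * Cauchy-Schwarz inequality and chain rule for the Euclidean structure *)

Section Euclidean.
Context {R : realType}.
Implicit Types n : nat.

Lemma dot_ge0 n (x : 'rV[R]_n) : 0 <= dot x x.
Proof. by apply: sumr_ge0 => i _; rewrite -expr2 sqr_ge0. Qed.

Lemma dotDr n (x y w : 'rV[R]_n) : dot x (y + w) = dot x y + dot x w.
Proof.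
by rewrite /dot -big_split; apply: eq_bigr => i _; rewrite mxE mulrDr.
Qed.

(** Cauchy-Schwarz, from the nonnegativity of the squared length of p x - q y for all scalars p and
    q. *)
Lemma sqr_dot_le n (x y : 'rV[R]_n) : dot x y ^+ 2 <= dot x x * dot y y.
Proof.
have expand (p q : R) :
    0 <= p ^+ 2 * dot x x - (p * q * dot x y) *+ 2 + q ^+ 2 * dot y y.
  have -> : p ^+ 2 * dot x x - (p * q * dot x y) *+ 2 + q ^+ 2 * dot y y =
      \sum_(i < n) (p * x ord0 i - q * y ord0 i) ^+ 2.
    rewrite /dot !mulr_sumr -sumrMnl -sumrB -big_split /=.
    by apply: eq_bigr => i _; ring.
  by apply: sumr_ge0 => i _; rewrite sqr_ge0.
have := dot_ge0 y; rewrite le_eqVlt => /predU1P[y0|y_gt0]; last first.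
  (* With p = y.y and q = x.y the quadratic form factors as y.y times the desired difference. *)
  have := expand (dot y y) (dot x y); set a := dot x x; set c := dot x y.
  have -> : dot y y ^+ 2 * a - (dot y y * c * c) *+ 2 + c ^+ 2 * dot y y =
      dot y y * (a * dot y y - c ^+ 2) by ring.
  by rewrite pmulr_rge0// subr_ge0.
have yi0 (i : 'I_n) : y ord0 i = 0.
  have /psumr_eq0P /(_ i isT)/eqP : \sum_(i < n) y ord0 i * y ord0 i = 0 by [].
  rewrite mulf_eq0 orbb => h; apply/eqP/h.
  by move=> j _; rewrite -expr2 sqr_ge0.
rewrite -y0 mulr0 /dot big1 ?expr0n// => i _.
by rewrite yi0 mulr0.
Qed.

Lemma norm_dot_le n (x y : 'rV[R]_n) : `|dot x y| <= enorm x * enorm y.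
Proof.
rewrite /enorm -sqrtrM ?dot_ge0// -sqrtr_sqr.
by rewrite ler_sqrt ?sqr_dot_le// mulr_ge0 ?dot_ge0.
Qed.

(** The differential of [g] is linear, so expanding [v] in the standard basis turns its value at [v]
    into a combination of partial derivatives. *)
Lemma is_derive_comp_grad n (g : 'rV[R]_n -> R) (z : R -> 'rV[R]_n)
    (t : R) (v : 'rV[R]_n) :
  is_derive t 1 z v -> differentiable g (z t) ->
  is_derive t 1 (g \o z) (dot (grad g (z t)) v).
Proof.
move=> [/derivable1_diffP dz vE] dg.
have dgz : differentiable (g \o z) t by exact: differentiable_comp.
split; first exact/derivable1_diffP.
rewrite deriveE// diff_comp//= -(deriveE _ dz) vE.
rewrite {1}(row_sum_delta v) linear_sum; apply: eq_bigr => i _.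
by rewrite linearZ /= mxE /partial deriveE// [RHS]mulrC.
Qed.

End Euclidean.

(** * From half-line difference quotients to ordinary derivatives and limits *)

Section Halfline.
Context {R : realType} (n : nat).
Implicit Types (x : R -> 'rV[R]_n) (t : R).

Lemma halfline_at_gt0 t : 0 < t -> halfline_at t = t^'.
Proof.
move=> t0; apply/seteqP; split=> A; rewrite /halfline_at /within/=; last first.
  by apply: filterS.
move=> wA; have : \forall s \near t^', 0 < s.
  by apply: nbhs_dnbhs; exact: lt_nbhsr.
by apply: filterS2 wA => s + /ltW; exact.
Qed.

Lemma is_derive_velocity x t : differentiable_halfline x -> 0 < t ->
  is_derive t 1 x (velocity x t).
Proof.
move=> dx t0; have := dx t (ltW t0).
rewrite /velocity halfline_at_gt0// => cq.
have sh : (fun h : R => h^-1 *: ((x \o shift t) h%:A - x t)) @ 0^' -->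
    lim (diff_quotient x t @ t^').
  apply: cvg_trans cq => A [e /= e0 qA]; exists e => //= h he h0.
  have -> : h^-1 *: ((x \o shift t) h%:A - x t) = diff_quotient x t (h + t).
    by rewrite /diff_quotient addrK /= [h%:A]mulr1.
  apply: qA; last by rewrite -subr_eq0 addrK.
  by move: he; rewrite /ball_/= opprD addrCA subrr addr0 sub0r.
by split; [apply/cvg_ex; eexists; exact: sh|exact: cvg_lim sh].
Qed.

(** For s > 0, x(s) = s q(s) + x(0), where the quotient q(s) converges and s tends to 0. *)
Lemma cvg_halfline0 x : differentiable_halfline x -> x s @[s --> 0^'+] --> x 0.
Proof.
move=> /(_ 0 (lexx 0)) /cvg_ex[v qv].
have {}qv : diff_quotient x 0 s @[s --> 0^'+] --> v.
  apply: cvg_trans qv; apply: cvg_app => A; rewrite /halfline_at.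
  case=> e /= e0 eA; exists e => //= s se s0.
  by apply: eA => //=; [rewrite gt_eqF|exact: ltW].
have s0 : (s : R) @[s --> 0^'+] --> (0 : R) by exact: cvg_at_right_filter.
have : s *: diff_quotient x 0 s + x 0 @[s --> 0^'+] --> 0 *: v + x 0.
  by apply: cvgD; [exact: cvgZ|exact: cvg_cst].
rewrite scale0r add0r; apply: cvg_trans; apply: near_eq_cvg.
by near=> s => /=; rewrite /diff_quotient subr0 scalerA divff ?scale1r ?subrK//.
Unshelve. all: by end_near.
Qed.

End Halfline.

(** * A scalar comparison argument with an exponentially decaying disturbance *)

Section Barrier.
Context {R : realType}.
Context (H : R -> R) (alpha beta c : R).
Context (cH : H s @[s --> 0^'+] --> H 0).
Context (dH : forall t : R, 0 < t -> derivable H t 1).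

Lemma is_derive_expRM (a t : R) :
  is_derive t 1 (fun s => expR (a * s)) (a * expR (a * t)).
Proof.
rewrite mulrC -[X in _ * X]mulr1.
exact: (is_derive1_comp (is_derive_expR _) (is_deriveZ a (is_derive_id t 1))).
Qed.

(** The differential inequality is required only strictly inside (0, b), so [b] can be a first exit
    time, where the sign of [H] is not yet known. *)
Lemma exp_lower_bound (b : R) : 0 <= b -> c <= H 0 ->
  (forall t : R, 0 < t < b ->
     - alpha * H t - c * (beta - alpha) * expR (- beta * t) <= 'D_1 H t) ->
  c * expR (- beta * b) <= H b.
Proof.
move=> b0 cH0 dHge.
(* The integrating factor exp(alpha t) makes the derivative of [G] equal to exp(alpha t) times the
   slack in the differential inequality. *)
pose G t := expR (alpha * t) * H t - c * expR (- (beta - alpha) * t).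
have dG (t : R) : 0 < t -> is_derive t 1 G
    (expR (alpha * t) *
     ('D_1 H t + alpha * H t + c * (beta - alpha) * expR (- beta * t))).
  move=> t0; have HD : is_derive t 1 H ('D_1 H t) by apply/derivableP/dH.
  have E (a : R) := is_derive_expRM a t.
  have D := is_deriveB (is_deriveM (E alpha) HD)
    (is_deriveZ c (E (- (beta - alpha)))).
  apply: (is_derive_eq D); rewrite /GRing.scale /=.
  have -> : expR (- (beta - alpha) * t) = expR (alpha * t) * expR (- beta * t).
    by rewrite -expRD; congr expR; ring.
  ring.
have : G 0 <= G b.
  move: b0 dHge; rewrite le_eqVlt => /predU1P[<-//|b0] dHge.
  apply: (@ger0_derive1_ndecr _ _ 0 b) => //.
  - by move=> t; rewrite in_itv/= => /andP[/dG[]].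
  - move=> t; rewrite in_itv/= => /andP[t0 tb].
    rewrite derive1E; have [_ ->] := dG t t0.
    rewrite mulr_ge0 ?expR_ge0//.
    have := dHge t; rewrite t0 tb => /(_ isT); lra.
  - apply/continuous_within_itvP => //; split.
    + move=> t; rewrite in_itv/= => /andP[t0 _].
      have [dGt _] := dG t t0.
      exact/differentiable_continuous/derivable1_diffP.
    + have cE (a : R) : expR (a * s) @[s --> 0^'+] --> expR (a * 0).
        apply: cvg_at_right_filter.
        have [dE _] := is_derive_expRM a 0.
        by move/derivable1_diffP/differentiable_continuous: dE; exact.
      by apply: cvgB; apply: cvgM => //; exact: cvg_cst.
    + apply: cvg_at_left_filter.
      have [dGb _] := dG b b0.
      exact/differentiable_continuous/derivable1_diffP.
  - exact: ltW.
rewrite /G !mulr0 expR0 mul1r mulr1 => Gb.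
have : 0 <= expR (alpha * b) * (H b - c * expR (- beta * b)).
  rewrite mulrBr mulrCA -expRD.
  have -> : alpha * b + - beta * b = - (beta - alpha) * b by ring.
  lra.
by rewrite pmulr_rge0 ?expR_gt0// subr_ge0.
Qed.

(* The disjunct [c = 0] covers a vanishing initial error: [H] may then start
   at 0, so the argument at the first exit time is not available, but the
   differential inequality holds outside the safe set as well. *)
Lemma barrier_ge0 : 0 <= c <= H 0 ->
  (forall t : R, 0 < t -> 0 <= H t \/ c = 0 ->
     - alpha * H t - c * (beta - alpha) * expR (- beta * t) <= 'D_1 H t) ->
  forall t : R, 0 <= t -> 0 <= H t.
Proof.
move=> /andP[c0 cH0] dHge t t0; rewrite leNgt; apply/negP => Ht.
move: c0; rewrite le_eqVlt => /predU1P[/esym c0|c0].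
  have : c * expR (- beta * t) <= H t.
    by apply: exp_lower_bound => // s /andP[s0 _]; apply: dHge => //; right.
  by rewrite c0 mul0r leNgt Ht.
(* At the first exit time [b] the lower bound on [0, b] gives [H b > 0]. *)
pose A := [set s | 0 <= s /\ H s < 0].
have A0 : A !=set0 by exists t.
have lA : lbound A 0 by move=> s [].
have iA : has_inf A by split => //; exists 0.
set b := inf A.
have b0 : 0 <= b by exact: lb_le_inf.
have Hb : 0 < H b.
  apply: (@lt_le_trans _ _ (c * expR (- beta * b))).
    by rewrite mulr_gt0 ?expR_gt0.
  apply: exp_lower_bound => // s /andP[s0 sb]; apply: dHge => //; left.
  rewrite leNgt; apply/negP => Hs.
  have : b <= s by apply: ge_inf; [exists 0|split => //; exact: ltW].
  by rewrite leNgt sb.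
(* Positivity persists to the right of [b], by [cH] if [b] is 0 and by differentiability otherwise,
   whereas [A] has points arbitrarily close to its infimum [b]. *)
have : \forall s \near b^'+, 0 < H s.
  have : H s @[s --> b^'+] --> H b.
    move: b0; rewrite le_eqVlt => /predU1P[<-//|b0].
    apply: cvg_at_right_filter.
    exact/differentiable_continuous/derivable1_diffP/dH.
  by move/cvgr_gt; apply.
move=> [e /= e0 He].
have [s As sb] := inf_adherent e0 iA.
have bs : b <= s by apply: ge_inf => //; exists 0.
have [_] := As; apply/negP; rewrite -leNgt.
move: bs; rewrite le_eqVlt => /predU1P[<-|bs]; first exact: ltW.
by apply/ltW/He => //=; rewrite ltr0_norm ?subr_lt0// opprB ltrBlDl//.
Qed.

End Barrier.

(** * Application to [h] along the projected closed-loop trajectory *)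

Theorem theorem4 (R : realType) (N Mu n m : nat)
  (X : set 'rV[R]_N) (U : set 'rV[R]_Mu) (Z : set 'rV[R]_n) (Vin : set 'rV[R]_m)
  (F : 'rV[R]_N -> 'rV[R]_Mu -> 'rV[R]_N)
  (f : 'rV[R]_n -> 'rV[R]_m -> 'rV[R]_n)
  (Pi : 'rV[R]_N -> 'rV[R]_n) (K : 'rV[R]_N -> 'rV[R]_m -> 'rV[R]_Mu)
  (k : 'rV[R]_n -> 'rV[R]_m) (h : 'rV[R]_n -> R)
  (xcl : 'rV[R]_N -> R -> 'rV[R]_N) (zs_dot : 'rV[R]_N -> R -> 'rV[R]_n)
  (S : set ('rV[R]_n * 'rV[R]_n)) (V : 'rV[R]_n * 'rV[R]_n -> R)
  (alpha beta a1 a2 tau Ch M : R) (x0 : 'rV[R]_N)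
  (ltnN : (n < N)%N) (ltmMu : (m < Mu)%N)
  (hFoM : FoM X U F) (hRoM : RoM Z Vin f)
  (hIntc : interconnection X U Z Vin Pi K k)
  (hxcl : forall x : 'rV[R]_N, X x -> classical_solution X (closed_loop F Pi K k) x (xcl x))
  (hzcl : forall x : 'rV[R]_N, X x -> differentiable_halfline (z_cl Pi xcl x))
  (hsmooth : smooth_on Z h) (hCBF : CBF Z Vin f alpha h)
  (hzs : forall x : 'rV[R]_N, X x ->
     safe_reference Z Vin f alpha h (z_cl Pi xcl x) (zs_dot x))
  (Ch0 : 0 < Ch)
  (hCh : forall x : 'rV[R]_N, S_FoM X Pi h x -> enorm (grad h (Pi x)) <= Ch)
  (M0 : 0 < M)
  (hM : forall t : R, 0 <= t ->
     enorm (e_dot Pi xcl zs_dot x0 t) <= M * enorm (e_dot Pi xcl zs_dot x0 0) * expR (- beta * t))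
  (hRTF : RTF X Z (z_cl Pi xcl) (e_dot Pi xcl zs_dot) S a1 a2 tau beta V)
  (alpha0 : 0 < alpha) (ltab : alpha < beta)
  (hx0 : S_FoM X Pi h x0)
  (hS : S (Pi x0, e_dot Pi xcl zs_dot x0 0))
  (hSV : S_V Z V h (alpha_e a1 a2 alpha beta Ch M) (Pi x0, e_dot Pi xcl zs_dot x0 0)) :
  forall t : R, 0 <= t -> S_FoM X Pi h (xcl x0 t).
Proof.
have Xx0 : X x0 by case: hx0.
have [xcl0 xclX] := hxcl _ Xx0.
have dz := hzcl _ Xx0; have hz := hzs _ Xx0.
have [hXZ _ _] := hIntc; have [Zh [_ ZZh hZh]] := hsmooth.
set z := z_cl Pi xcl x0 in dz hz.
have z0 : z 0 = Pi x0 by rewrite /z /z_cl xcl0.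
have Xz (t : R) : 0 <= t -> X (xcl x0 t) by move=> /xclX[].
have dh (t : R) : 0 <= t -> differentiable h (z t).
  by move=> t0; apply: (hZh [::]); exact/ZZh/hXZ/Xz.
pose e (t : R) := e_dot Pi xcl zs_dot x0 t.
have zE (t : R) : velocity z t = zs_dot x0 t + e t.
  by rewrite /e /e_dot addrC subrK.
have dH (t : R) : 0 < t ->
    is_derive t 1 (h \o z) (dot (grad h (z t)) (velocity z t)).
  move=> t0; apply: is_derive_comp_grad; last exact/dh/ltW.
  exact: is_derive_velocity.
have ba0 : 0 < beta - alpha by rewrite subr_gt0.
pose c := Ch * M * enorm (e 0) / (beta - alpha).
have e0_ge0 : 0 <= enorm (e 0) by exact: sqrtr_ge0.
have c_ge0 : 0 <= c by rewrite divr_ge0 ?mulr_ge0// ltW.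
have cE : c * (beta - alpha) = Ch * M * enorm (e 0) by rewrite /c divfK ?gt_eqF.
have c_le : c <= (h \o z) 0.
  rewrite /= z0.
  have [_ _ [a1_gt0 a2_gt0 /(_ _ hS)/andP[/= a1V Va2]] _] := hRTF.
  have [_] := hSV; rewrite /h_V/= -/(e 0) in a1V Va2 * => hV.
  have [h0|e0_neq0] := eqVneq (enorm (e 0)) 0.
    by rewrite /c h0 mulr0 mul0r; case: hx0.
  (* Both bounds on [V] at the initial point, divided by the nonzero initial error. *)
  have a12 : a1 <= a2.
    rewrite -(@ler_pM2r _ (enorm (e 0))) ?lt_def ?e0_neq0//.
    exact: le_trans Va2.
  have ae_gt0 : 0 < alpha_e a1 a2 alpha beta Ch M.
    by rewrite divr_gt0 ?mulr_gt0 ?exprn_gt0.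
  rewrite -(ler_pM2l ae_gt0).
  (* [alpha_e] is tuned so that [Ch], [M] and beta - alpha cancel; what remains is at most a1 |e(0)|
     <= V <= alpha_e h, since a1 / a2 <= 1. *)
  have -> : alpha_e a1 a2 alpha beta Ch M * c = a1 / a2 * (a1 * enorm (e 0)).
    by rewrite /c /alpha_e; field; rewrite !gt_eqF.
  apply: (@le_trans _ _ (a1 * enorm (e 0))); last by rewrite -subr_ge0; lra.
  apply: ler_piMl; last by rewrite ler_pdivrMr ?mul1r.
  by rewrite mulr_ge0// ltW.
suff hz_ge0 : forall t : R, 0 <= t -> 0 <= (h \o z) t.
  by move=> t t0; split; [exact: Xz|exact: hz_ge0].
apply: (@barrier_ge0 _ (h \o z) alpha beta c).
- exact: cvg_comp (cvg_halfline0 dz) (differentiable_continuous (dh 0 (lexx 0))).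
- by move=> s /dH[].
- by rewrite c_ge0.
- move=> s s0 Hs; have [_ ->] := dH s s0.
  rewrite zE dotDr cE.
  have [_ ref] := hz s (ltW s0).
  suff : `|dot (grad h (z s)) (e s)| <= Ch * M * enorm (e 0) * expR (- beta * s).
    by rewrite ler_norml => /andP[+ _]; move: ref => /=; lra.
  apply: le_trans (norm_dot_le _ _) _.
  have es := hM _ (ltW s0).
  (* In a safe state [Ch] bounds the gradient. If c = 0 the state may be unsafe, but then e(0) = 0
     and the decay estimate forces e(s) = 0, whatever the gradient. *)
  case: Hs => [Hs|c0].
    rewrite -!mulrA; apply: ler_pM; rewrite ?sqrtr_ge0//; last by rewrite mulrA.
    by apply: hCh; split => //; exact/Xz/ltW.
  have e0 : enorm (e 0) = 0.
    move/eqP: cE; rewrite c0 mul0r eq_sym !mulf_eq0.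
    by rewrite (gt_eqF Ch0) (gt_eqF M0) => /eqP.
  move: es; rewrite -/(e 0) -/(e s) e0 !(mulr0, mul0r) => es.
  by rewrite mulr_ge0_le0 ?sqrtr_ge0.
Qed.
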